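(* For each positive integer $n$, the image of the free group $F_n$ of rank $n$ under $\mathrm{scl}$ contains a subset which, with the usual order of $\mathbb R$, is well-ordered of ordinal type $\omega^{\lfloor n/4\rfloor}$. The image of $F_\infty$ (the free group of countably infinite rank) under $\mathrm{scl}$ contains a subset which is well-ordered of ordinal type $\omega^\omega$.
   Context: For a group $G$ and $g\in[G,G]$, $\mathrm{cl}(g)$ is the least number of commutators in $G$ whose product is $g$, and $\mathrm{scl}(g)=\lim_{n\to\infty}\mathrm{cl}(g^n)/n$. The image of a free group $F$ under $\mathrm{scl}$ is the set of real numbers $\{\mathrm{scl}(g): g\in[F,F]\}$. *)

(* Defs.v *)
From HB Require Import structures.
From mathcomp Require Import all_boot all_order all_algebra.
From mathcomp Require Import all_classical all_reals all_analysis wochoice.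

Set Implicit Arguments.
Unset Strict Implicit.
Unset Printing Implicit Defensive.

Import Order.TTheory GRing.Theory Num.Theory.
Import numFieldNormedType.Exports.

Local Open Scope classical_set_scope.

Section FreeGroup.
Variable X : choiceType.

(* (x, true) stands for the generator x and (x, false) for its inverse. *)
Local Notation letter := (X * bool)%type.

Definition inv_letter (a : letter) : letter := (a.1, ~~ a.2).

Definition reduced (w : seq letter) : bool :=
  sorted (fun a b : letter => b != inv_letter a) w.

Definition free_group : Type := {w : seq letter | reduced w}.
HB.instance Definition _ := Choice.on free_group.

(* The reduced form of a :: w, for w reduced. *)
Definition push (a : letter) (w : seq letter) : seq letter :=
  if w is b :: w' then if b == inv_letter a then w' else a :: w else [:: a].

(* The reduced form of u ++ v, for v reduced. *)
Definition word_mul (u v : seq letter) : seq letter := foldr push v u.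

Definition word_inv (w : seq letter) : seq letter := rev (map inv_letter w).

Lemma inv_letterK : involutive inv_letter.
Proof. by case=> x b; rewrite /inv_letter /= negbK. Qed.

Lemma reduced_push a w : reduced w -> reduced (push a w).
Proof.
case: w => [|b w] //= rw; case: ifPn => [_|nba]; first exact: path_sorted rw.
by rewrite /= nba.
Qed.

Lemma reduced_mul u v : reduced v -> reduced (word_mul u v).
Proof. by move=> rv; elim: u => //= a u IHu; apply: reduced_push. Qed.

Lemma reduced_inv w : reduced w -> reduced (word_inv w).
Proof.
rewrite /reduced /word_inv rev_sorted sorted_map; apply: sub_sorted => a b /=.
by rewrite inv_letterK eq_sym.
Qed.

Lemma push_invK a w : reduced w -> push (inv_letter a) (push a w) = w.
Proof.
case: w => [|b w] /=; first by rewrite inv_letterK eqxx.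
case: eqVneq => [->|_ _] /=; last by rewrite inv_letterK eqxx.
by case: w => [|c w] //= /andP[/negPf ->].
Qed.

Lemma pushK_inv a w : reduced w -> push a (push (inv_letter a) w) = w.
Proof. by move=> rw; rewrite -{1}[a]inv_letterK push_invK. Qed.

Lemma mul_push a u v :
  reduced v -> word_mul (push a u) v = push a (word_mul u v).
Proof.
move=> rv; case: u => [|b u] //=; case: ifPn => [/eqP ->|//].
by rewrite pushK_inv // reduced_mul.
Qed.

Lemma word_mulA u v w :
  reduced w -> word_mul u (word_mul v w) = word_mul (word_mul u v) w.
Proof. by move=> rw; elim: u => //= a u ->; rewrite mul_push. Qed.

Lemma word_mulw1 w : reduced w -> word_mul w [::] = w.
Proof.
elim: w => //= a w IHw rw; have /IHw-> := path_sorted rw.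
by case: w rw {IHw} => //= b w /andP[/negPf ->].
Qed.

Lemma word_mulVw w : reduced w -> word_mul (word_inv w) w = [::].
Proof.
rewrite /word_inv; elim: w => //= a w IHw rw.
rewrite rev_cons /word_mul foldr_rcons /= inv_letterK eqxx.
exact: IHw (path_sorted rw).
Qed.

Lemma word_invK : involutive word_inv.
Proof.
by move=> w; rewrite /word_inv map_rev revK -map_comp (eq_map inv_letterK) map_id.
Qed.

Definition fg_one : free_group := exist _ [::] isT.
Definition fg_inv (g : free_group) : free_group :=
  exist _ (word_inv (val g)) (reduced_inv (valP g)).
Definition fg_mul (g h : free_group) : free_group :=
  exist _ (word_mul (val g) (val h)) (reduced_mul (val g) (valP h)).

Fact fg_mulA : associative fg_mul.
Proof. by move=> g h k; apply/val_inj/word_mulA/(valP k). Qed.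

Fact fg_mul1 : left_id fg_one fg_mul.
Proof. by move=> g; apply/val_inj. Qed.

Fact fg_1mul : right_id fg_one fg_mul.
Proof. by move=> g; apply/val_inj/word_mulw1/(valP g). Qed.

Fact fg_mulV : left_inverse fg_one fg_inv fg_mul.
Proof. by move=> g; apply/val_inj/word_mulVw/(valP g). Qed.

Fact fg_Vmul : right_inverse fg_one fg_inv fg_mul.
Proof.
move=> g; apply/val_inj; rewrite /= -{1}[val g]word_invK.
exact: word_mulVw (reduced_inv (valP g)).
Qed.

HB.instance Definition _ :=
  isGroup.Build free_group fg_mulA fg_mul1 fg_1mul fg_mulV fg_Vmul.

End FreeGroup.

Section Scl.
Local Open Scope group_scope.
Variable G : groupType.

Definition derived_subgroup : set G :=
  smallest [set H : set G | group_closed (mem H)]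
    [set [~ x, y] | x in [set: G] & y in [set: G]].

Definition commutator_product (g : G) (k : nat) : Prop :=
  exists2 s : seq (G * G), size s = k & g = \prod_(p <- s) [~ p.1, p.2].

(* The default 0 is taken only when g is not a product of commutators. *)
Definition cl (g : G) : nat :=
  xget 0%N [set k | commutator_product g k /\
                    forall m, commutator_product g m -> (k <= m)%N].

Local Open Scope ring_scope.

Definition scl (R : realType) (g : G) : R :=
  lim ((fun n : nat => (cl (g ^+ n)%g)%:R / n%:R : R) @ \oo).

Definition scl_image (R : realType) : set R :=
  [set scl R g | g in derived_subgroup].

End Scl.

Arguments scl_image G R : clear implicits.

(* If B has order type beta, then the finitely supported functions B -> nat,
   compared at the largest argument where they differ, have order type
   omega ^ beta. *)

Definition omega_pow d (B : orderType d) : set (B -> nat) :=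
  [set f | finite_set [set b | f b != 0%N]].
Arguments omega_pow {d} B.

Definition omega_pow_lt d (B : orderType d) (f g : B -> nat) : Prop :=
  exists b : B, (f b < g b)%N /\ forall c : B, (b < c)%O -> f c = g c.

Definition well_ordered_of_type_omega_pow (R : realType) d (B : orderType d)
    (S : set R) : Prop :=
  wo_chain (<=%R : rel R) (mem S) /\
  exists h : (B -> nat) -> R,
    set_bij (omega_pow B) S h /\
    {in omega_pow B &, forall f g, @omega_pow_lt d B f g <-> (h f < h g)%R}.

Arguments well_ordered_of_type_omega_pow {R d} B S.

(* Main.v *)
Require Import Defs.
From mathcomp Require Import all_boot all_order all_algebra.
From mathcomp Require Import all_classical all_reals all_analysis.
From mathcomp Require Import wochoice zify ring lra.

(* For p = q + 3, the element u = b a b^-p a^-1 b a b a^-1 b^q of the free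
   group on a, b has scl 1 - 1/(2p), which increases to 1 with p. For copies
   u_0, ..., u_k of such elements on disjoint pairs of generators and one more
   generator c, the product of the conjugates c^j u_j c^-j has scl
   sum_j scl(u_j) + k/2, which remains true if u_0 is repeated. With exponents
   p_j = 2^(e_j), where e_j decreases in j fast enough in terms of a function
   f : nat -> nat, these sums are ordered like the finitely supported f.

   Upper bounds for scl come from (x y)^n = x^n y^n modulo n/2 commutators.
   Lower bounds come from a quasimorphism of defect 1, taking values at most 4k
   at products of k commutators: it adds up over the syllables x^n of a reduced
   word a weight depending on n and on the letters next to the syllable. *)

Import Order.TTheory GRing.Theory Num.Theory.
Import numFieldNormedType.Exports.

Local Open Scope classical_set_scope.

(** * Products of commutators *)

Section CommutatorProducts.
Local Open Scope group_scope.
Variable G : groupType.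
Implicit Types (g h x y z : G) (k l n : nat).

Lemma commutator_product1 : commutator_product (1 : G) 0.
Proof. by exists [::]; rewrite ?big_nil. Qed.

Lemma commutator_product_commg x y : commutator_product [~ x, y] 1.
Proof. by exists [:: (x, y)]; rewrite ?big_seq1. Qed.

Lemma commutator_productM g h k l : commutator_product g k ->
  commutator_product h l -> commutator_product (g * h) (k + l).
Proof.
by move=> [r <- ->] [s <- ->]; exists (r ++ s); rewrite ?size_cat ?big_cat.
Qed.

Lemma commutator_productJ g x k :
  commutator_product g k -> commutator_product (g ^ x) k.
Proof.
move=> [r <- ->]; exists [seq (p.1 ^ x, p.2 ^ x) | p <- r].
  by rewrite size_map.
by rewrite big_map conjg_prod; apply: eq_bigr => p _; rewrite conjRg.
Qed.

Lemma commutator_productX g k n :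
  commutator_product g k -> commutator_product (g ^+ n) (n * k).
Proof.
move=> gk; elim: n => [|n IHn]; first exact: commutator_product1.
by rewrite expgS mulSn; apply: commutator_productM.
Qed.

(** Congruence up to [k] commutators. Conjugates of commutators are commutators, so it is compatible
    with products and the errors add up. *)
Definition comm_close k g h := commutator_product (g / h) k.

Lemma comm_close0 g : comm_close 0 g g.
Proof. by rewrite /comm_close mulgV; apply: commutator_product1. Qed.

Lemma comm_close_trans {g h x k l} :
  comm_close k g h -> comm_close l h x -> comm_close (k + l) g x.
Proof.
by move=> gh hx; rewrite /comm_close -(divgKA h); apply: commutator_productM.
Qed.

Lemma comm_closeM g h x y k l :
  comm_close k g x -> comm_close l h y -> comm_close (k + l) (g * h) (x * y).
Proof.
move=> gx hy; have -> : (k + l = l + k)%N by rewrite addnC.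
rewrite /comm_close.
have -> : g * h / (x * y) = (h / y) ^ g^-1 * (g / x).
  by rewrite conjgE invgM invgK !mulgA mulgVK.
exact: commutator_productM (commutator_productJ _ _ _ hy) gx.
Qed.

Lemma comm_closeJ g x : comm_close 1 (g ^ x) g.
Proof.
have -> : comm_close 1 (g ^ x) g = commutator_product [~ x, g^-1] 1.
  by rewrite /comm_close conjgE commgEl conjgE invgK !mulgA.
exact: commutator_product_commg.
Qed.

Lemma comm_close_prod (I : Type) (r : seq I) (E F : I -> G) k :
  (forall i, comm_close k (E i) (F i)) ->
  comm_close (size r * k) (\prod_(i <- r) E i) (\prod_(i <- r) F i).
Proof.
move=> EF; elim: r => [|i r IHr]; first by rewrite !big_nil; apply: comm_close0.
by rewrite !big_cons mulSn; apply: comm_closeM.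
Qed.

(** Induction in steps of two: from [n] to [n.+2] the quotient is multiplied by a conjugate of a
    single commutator. *)
Lemma comm_close_expM x y n :
  comm_close n./2 ((x * y) ^+ n) (x ^+ n * y ^+ n).
Proof.
have [m] := ubnP n; elim: m n => // m IHm [|[|n]] lt_nm.
- by rewrite !expg0 mulg1; apply: comm_close0.
- by rewrite !expg1; apply: comm_close0.
have /IHm : (n < m)%N by lia.
rewrite /comm_close => IHn; have -> : (n.+2./2 = n./2 + 1)%N by rewrite addn1.
have ty : y^-1 * y ^- n = y ^- n * y^-1 by rewrite -!invgM -expgS -expgSr.
have -> : (x * y) ^+ n.+2 / (x ^+ n.+2 * y ^+ n.+2)
   = (x * y) ^+ n / (x ^+ n * y ^+ n)
     * [~ y ^+ n / x, x * x * y] ^ (x / (x ^+ n * y ^+ n * x * y * x)).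
  rewrite !expgSr conjgE commgEl conjgE; move: (y ^+ n) ty => t ty.
  rewrite !(invgM, invgK, mulgA, mulgVK, mulgK).
  by rewrite -(mulgA _ y^-1 t^-1) ty mulgA.
apply: commutator_productM => //.
exact/commutator_productJ/commutator_product_commg.
Qed.

Lemma comm_close_exp_prod (I : Type) (r : seq I) (F : I -> G) h n :
  comm_close (size r * n./2) ((\prod_(i <- r) F i * h) ^+ n)
    (\prod_(i <- r) F i ^+ n * h ^+ n).
Proof.
elim: r => [|i r IHr]; first by rewrite !big_nil !mul1g; apply: comm_close0.
rewrite !big_cons -!mulgA mulSn.
apply: comm_close_trans (comm_close_expM _ _ _) _.
by rewrite -[(size r * _)%N]add0n; apply: comm_closeM IHr; apply: comm_close0.
Qed.

Lemma expg_mul_conj x y n :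
  (x * y) ^+ n = \prod_(0 <= i < n) y ^ (x ^- i.+1) * x ^+ n.
Proof.
elim: n => [|n IHn]; first by rewrite big_geq ?mulg1.
rewrite expgSr IHn big_nat_recr //= conjgE invgK expgSr.
by rewrite !(invgM, invgK, mulgA, mulgVK, mulgK).
Qed.

(* With p = q + 3, the deficit 1/(2p) of its scl comes from disc pieces made of
   p syllables b and one syllable b^-p, each of them between a and a^-1. *)
Definition block (a b : G) (q : nat) : G :=
  b * a * (b ^+ q.+3)^-1 * a^-1 * b * a * b * a^-1 * b ^+ q.

(** The block is [b * c ^- q.+3 * b * c * b ^+ q]; the conjugation rotates this word so that the
    isolated [c] comes first. *)
Lemma block_conj a b q (c := b ^ a^-1) :
  block a b q ^ (b * c ^- q.+3 * b) = c * (b ^+ q.+1 * c ^- q.+3 * b).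
Proof.
rewrite /block /c -conjXg !conjgE !expgS !(invgM, invgK, mulgA, mulgVK, mulgK).
by rewrite !(mulVg, mul1g) -(mulgA _ (b ^+ q) b) -expgSr expgS mulgA.
Qed.

(** Up to conjugation the block is [c * z]. With p = q + 3, its p-th power is a product of p + 1
    pieces: p - 1 conjugates of [z], whose n-th powers are close to [b ^- n], a conjugate of
    [b ^+ q.+1], and [b]. The exponents of [b] then add up to 0. Separating the pieces takes p times
    [n./2] commutators. *)
Lemma comm_close_block a b q n :
  comm_close (q.+3 * n./2 + q.+2 * (n./2 + 3) + 1)
    ((block a b q ^+ q.+3) ^+ n) 1.
Proof.
set c := b ^ a^-1; set y := b * c ^- q.+3 * b.
suff: comm_close (q.+3 * n./2 + q.+2 * (n./2 + 3) + 1)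
    (((block a b q ^ y) ^+ q.+3) ^+ n) 1.
  rewrite /comm_close !divg1 -!conjXg => /(commutator_productJ _ y^-1).
  by rewrite conjgK.
rewrite block_conj -/c; set z := b ^+ q.+1 * c ^- q.+3 * b.
(* [z] is conjugate to [c ^- q.+3 * b ^+ q.+2]; splitting the power costs [n./2], and each of three
   conjugations costs 1. *)
have zn x : comm_close (n./2 + 3) ((z ^ x) ^+ n) (b ^- n).
  have -> : (n./2 + 3 = 1 + (1 + (n./2 + (1 + 0))))%N by lia.
  rewrite -conjXg; apply: comm_close_trans (comm_closeJ _ _) _.
  have -> : z = (c ^- q.+3 * b ^+ q.+2) ^ b ^- q.+1.
    by rewrite /z conjgE invgK (expgS b q.+1) !mulgA mulgK.
  rewrite -conjXg; apply: comm_close_trans (comm_closeJ _ _) _.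
  apply: comm_close_trans (comm_close_expM _ _ _) _.
  have -> : b ^- n = (b ^- q.+3) ^+ n * (b ^+ q.+2) ^+ n.
    by rewrite expVgn -!expgnA !mulSn [(n + (n + _))%N]addnC expgnDr invgM
      mulgVK.
  apply: comm_closeM; last exact: comm_close0.
  by rewrite /c -conjXg -conjVg -conjXg; apply: comm_closeJ.
(* The last conjugate of [z] absorbs the trailing [c ^+ q.+3], which leaves a conjugate of
   [b ^+ q.+1] followed by [b]. *)
rewrite (expg_mul_conj c z q.+3) big_nat_recr //= -mulgA conjgE invgK -(mulgA
  (c ^+ _)) mulgVK.
pose F i := z ^ (c ^- i.+1); have -> : c ^+ q.+3 * z = (b ^+ q.+1) ^ (c ^-
  q.+3) * b.
  by rewrite /z conjgE invgK !mulgA.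
have -> : (q.+3 * n./2 + q.+2 * (n./2 + 3) + 1 =
           q.+2 * n./2 + (q.+2 * (n./2 + 3) + (n./2 + (1 + 0))))%N by lia.
have := comm_close_exp_prod _ (index_iota 0 q.+2) F ((b ^+ q.+1) ^ (c ^- q.+3)
  * b) n.
rewrite size_iota subn0 => /comm_close_trans; apply.
have e1 : 1 = \prod_(0 <= i < q.+2) b ^- n * ((b ^+ q.+1) ^+ n * b ^+ n).
  rewrite prodg_const_nat subn0 expVgn -!expgnA -expgnDr.
  have -> : (q.+1 * n + n = n * q.+2)%N by lia.
  by rewrite mulVg.
rewrite [X in comm_close _ _ X]e1; apply: comm_closeM.
  have := comm_close_prod _ (index_iota 0 q.+2) (fun i =>
    F i ^+ n) (fun=> b ^- n).
  by rewrite size_iota; apply=> i; apply: zn.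
apply: comm_close_trans (comm_close_expM _ _ _) _.
apply: comm_closeM; last exact: comm_close0.
by rewrite -conjXg; apply: comm_closeJ.
Qed.

(** Replacing the two powers of [c], a conjugate of [b], by powers of [b] costs one commutator each
    and leaves 1. *)
Lemma commutator_product_block a b q : exists k, commutator_product (block a b
  q) k.
Proof.
exists (0 + 1 + 0 + 1)%N; rewrite -[block a b q]divg1.
set c := b ^ a^-1.
have -> : block a b q = b * (c ^- q.+3) * (b * c * b ^+ q).
  by rewrite /block /c -conjXg !conjgE invgK !(invgM, invgK, mulgA).
have -> : 1 = b * b ^- q.+3 * (b * b * b ^+ q).
  by rewrite -(mulgA b b) -!expgS (expgSr b q.+2) invgM (mulgA b b^-1) mulgV
    mul1g mulVg.
apply: comm_closeM.
  by apply: comm_closeM (comm_close0 _) _; rewrite /c -conjXg -conjVg;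
    apply: comm_closeJ.
rewrite -[1%N in X in comm_close X]addn0.
apply: comm_closeM; last exact: comm_close0.
rewrite -[1%N in X in comm_close X]add0n.
by apply: comm_closeM (comm_close0 _) (comm_closeJ _ _).
Qed.

End CommutatorProducts.

(** * Bounds for scl *)

Section SclBounds.
Local Open Scope ring_scope.
Variables (R : realType) (G : groupType).
Implicit Types (g h : G) (k n N : nat) (s t : R).

Lemma commutator_product_derived g k :
  commutator_product g k -> derived_subgroup g.
Proof.
move=> [r _ ->] H [Hgroup Hcomm].
have HM := group_closedM Hgroup.
apply: set_mem; elim/big_ind: _ => [||p _].
- by case: Hgroup.
- exact: HM.
- by apply/mem_set/Hcomm; exists p.1 => //; exists p.2.
Qed.

Lemma clP g k : commutator_product g k ->
  commutator_product g (cl g) /\ (cl g <= k)%N.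
Proof.
move=> gk; have [|l gl minl] := @ex_minnP (fun l =>
  `[< commutator_product g l >]).
  by exists k; apply/asboolP.
suff [gc minc] : commutator_product g (cl g) /\
    forall l, commutator_product g l -> (cl g <= l)%N by split;
      last exact: minc.
apply: (@xgetPex _ _ [set k | commutator_product g k /\
                    forall m, commutator_product g m -> (k <= m)%N]).
exists l; split; first exact/asboolP.
by move=> m gm; apply: minl; apply/asboolP.
Qed.

(** Bounds for scl stated without a limit: [t] is the slope, and [C] disappears after division by
    [N]. *)
Definition cl_upper g t := exists C : R, forall N,
  exists2 k, commutator_product (g ^+ N)%g k & k%:R <= t * N%:R + C.

Definition cl_lower g t := exists C : R, forall N k,
  commutator_product (g ^+ N)%g k -> t * N%:R - C <= k%:R.

Lemma scl_eq g t : cl_upper g t -> cl_lower g t -> scl R g = t.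
Proof.
move=> [C upC] [D lowD]; rewrite /scl; apply/cvg_lim; first exact: Rhausdorff.
(* The shift makes the divisor [n.+1], which is never zero. *)
rewrite -cvg_shiftS.
have cvgE (E : R) : (fun n => t + E * harmonic n) @ \oo --> t.
  rewrite -[X in _ --> X]addr0 -[X in _ --> _ + X](mulr0 E).
  by apply: cvgD; [exact: cvg_cst | apply: cvgM (cvg_cst _) cvg_harmonic].
apply: (squeeze_cvgr _ (cvgE (- D)) (cvgE C)); apply: nearW => n.
have n0 : 0 < n.+1%:R :> R by rewrite ltr0n.
have [k gk lek] := upC n.+1; have [/lowD gec lec] := clP _ _ gk.
have {}lek : (cl (g ^+ n.+1)%g)%:R <= t * n.+1%:R + C.
  by apply: le_trans lek; rewrite ler_nat.
rewrite ler_pdivlMr // ler_pdivrMr // !mulrDl -!mulrA mulVf ?gt_eqF // !mulr1.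
by rewrite gec.
Qed.

Lemma cl_upperJ g x t : cl_upper g t -> cl_upper (g ^ x)%g t.
Proof.
move=> [C upC]; exists C => N; have [k gk lek] := upC N.
by exists k => //; rewrite -conjXg; apply: commutator_productJ.
Qed.

Lemma half_le n : (n./2)%:R <= n%:R / 2 :> R.
Proof. by rewrite ler_pdivlMr // -natrM ler_nat; lia. Qed.

Lemma cl_upperM g h s t :
  cl_upper g s -> cl_upper h t -> cl_upper (g * h)%g (s + t + 2^-1).
Proof.
move=> [C upC] [D upD]; exists (C + D) => N.
have [k gk lek] := upC N; have [l hl lel] := upD N.
exists (N./2 + (k + l))%N.
  have := commutator_productM _ _ _ _ _ gk hl; rewrite -[(_ * _)%g]divg1.
  by move/(comm_close_trans _ (comm_close_expM _ _ _ _));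
    rewrite /comm_close divg1.
have := half_le N; rewrite !natrD; nra.
Qed.

(** Division of [N] by [p] leaves fewer than [p] factors [g], which cost [k] each and only enter the
    constant. *)
Lemma cl_upper_root g k p s C (f : nat -> nat) : (0 < p)%N -> 0 <= s ->
  commutator_product g k ->
  (forall n, commutator_product ((g ^+ p) ^+ n)%g (f n)) ->
  (forall n, (f n)%:R <= s * n%:R + C) ->
  cl_upper g (s / p%:R).
Proof.
move=> p0 s0 gk gf fC; exists (C + (p * k)%:R) => N.
exists (f (N %/ p) + (N %% p) * k)%N.
  rewrite {1}(divn_eq N p) expgnDr mulnC expgnA.
  exact/commutator_productM/commutator_productX.
have le1 : (N %/ p)%:R <= N%:R / p%:R :> R.
  by rewrite ler_pdivlMr ?ltr0n // -natrM ler_nat leq_divM.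
have le2 : ((N %% p) * k)%:R <= (p * k)%:R :> R.
  by rewrite ler_nat leq_mul2r ltnW ?orbT // ltn_pmod.
have := fC (N %/ p)%N; have := ler_wpM2l s0 le1.
by rewrite natrD mulrCA mulrC; lra.
Qed.

Lemma cl_upper_block (a b : G) q :
  cl_upper (block _ a b q) (1 - (2 * q.+3%:R)^-1).
Proof.
have [k uk] := commutator_product_block _ a b q.
(* The numerator is the slope of the bound [f] below for the [q.+3]-th power of the block. *)
have -> : 1 - (2 * q.+3%:R)^-1 = (q.+3%:R - 2^-1) / q.+3%:R :> R.
  have := ler0n R q => q0; by field; lra.
pose f n := (q.+3 * n./2 + q.+2 * (n./2 + 3) + 1)%N.
apply: (cl_upper_root _ k q.+3 _ (3 * q.+3%:R) f) => // [|n|n].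
- by rewrite -natr1 -natr1 -natr1; have := ler0n R q; lra.
- by have := comm_close_block _ a b q n; rewrite /comm_close divg1.
- have := half_le n; rewrite /f !(natrD, natrM) -!(natr1 q.+2).
  have := ler0n R q.+2; nra.
Qed.

End SclBounds.

(** * Reduced words *)

Section Quasimorphisms.
Local Open Scope ring_scope.
Variables (R : realType) (G : groupType) (phi : G -> R).
Hypothesis phiV : forall g, phi g^-1%g = - phi g.
Hypothesis phiM : forall g h, `|phi g + phi h - phi (g * h)%g| <= 1.

(** In [[~ x, y]], written as [x^-1 * (y^-1 * (x * y))], the values cancel and the three products
    cost 1 each; multiplying the commutator to the rest costs 1 more. *)
Lemma quasimorphism_commutator_product g k :
  commutator_product g k -> phi g <= 4 * k%:R.
Proof.
have leM g1 h1 : phi (g1 * h1)%g <= phi g1 + phi h1 + 1.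
  by have := phiM g1 h1; rewrite ler_norml => /andP[]; lra.
move=> [s <- ->]; elim: s => [|p s IHs] /=.
  by rewrite big_nil; have := phiV 1%g; rewrite invg1; lra.
rewrite big_cons -natr1; apply: le_trans (leM _ _) _.
have := leM p.1^-1%g (p.1 ^ p.2)%g; have := leM p.2^-1%g (p.1 * p.2)%g.
have := leM p.1 p.2; rewrite -commgEl -conjgE !phiV; lra.
Qed.

Lemma quasimorphism_cl_lower g s (C : R) :
  (forall N, s * N%:R - C <= phi (g ^+ N)%g) -> cl_lower R G g (s / 4).
Proof.
move=> sN; exists (C / 4) => N k /quasimorphism_commutator_product.
by have := sN N; lra.
Qed.

End Quasimorphisms.

Section ReducedWords.
Variable X : choiceType.
Implicit Types (a b : X * bool) (p q r u v w : seq (X * bool)).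

(** The legs of a tripod are read outwards from its centre, so [word_inv p ++ q] is the path from
    the tip of [p] to the tip of [q]. *)
Definition apart p q : bool :=
  if p is a :: _ then if q is b :: _ then a != b else true else true.

Lemma apart_sym p q : apart p q = apart q p.
Proof. by case: p q => [|a p] [|b q] //=; rewrite eq_sym. Qed.

Lemma word_inv_cons a p q :
  word_inv (a :: p) ++ q = word_inv p ++ inv_letter a :: q.
Proof. by rewrite /word_inv /= rev_cons cat_rcons. Qed.

Lemma reduced_join p q :
  reduced (word_inv p ++ q) = [&& reduced p, reduced q & apart p q].
Proof.
elim: p q => [|a p IHp] q; first by rewrite andbT.
rewrite word_inv_cons IHp.
case: q => [|b q] /=; first by case: p {IHp} => //= c p; rewrite !andbT andbC.
rewrite inv_letterK; case: p {IHp} => [|c p] /=.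
  by rewrite andbT [b == a]eq_sym andbC.
by rewrite [b == a]eq_sym; do 2!case: (_ != _); rewrite /= ?andbF ?andbT.
Qed.

Lemma word_mul_reduced_cat u v : reduced (u ++ v) -> word_mul u v = u ++ v.
Proof.
elim: u => //= a u IHu ruv; rewrite IHu; last exact: path_sorted ruv.
by case: (u ++ v) ruv => //= b w /andP[/negPf ->].
Qed.

(* Cancellation in the product u v leaves a tripod with legs p, q, r. *)
Lemma tripod_split u v : reduced u -> reduced v -> exists p q r,
  [/\ [&& reduced p, reduced q & reduced r],
      [&& apart p q, apart q r & apart r p],
      u = word_inv p ++ q, v = word_inv q ++ r &
      word_mul u v = word_inv p ++ r].
Proof.
move=> ru rv.
(* From an empty [q], the common first letters of [p] and [r] move to [q] one by one. The two other
   conditions [apart] hold because [u] and [v] are reduced. *)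
suff H : forall n p q r, (size p <= n)%N -> u = word_inv p ++ q ->
    v = word_inv q ++ r -> exists p q r,
    [/\ u = word_inv p ++ q, v = word_inv q ++ r & apart r p].
  have [||p [q [r [eu ev arp]]]] := H _ (word_inv u) [::] v (leqnn _) => //.
    by rewrite word_invK cats0.
  exists p, q, r; move: (ru) (rv); rewrite eu ev !reduced_join.
  move=> /and3P[-> -> ->] /and3P[_ rr ->]; split=> //; rewrite ?rr //.
  have rp : reduced p by move: ru; rewrite eu reduced_join => /andP[].
  have rq : reduced q by move: rv; rewrite ev reduced_join => /andP[].
  have -> : word_mul (word_inv p ++ q) (word_inv q ++ r) = word_mul (word_inv
    p) r.
    rewrite /word_mul foldr_cat -/(word_mul q _) -/(word_mul _ _);
      congr word_mul.
    rewrite -word_mul_reduced_cat -?ev // word_mulA //.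
    by rewrite -{1}[q]word_invK word_mulVw ?reduced_inv.
  by rewrite word_mul_reduced_cat // reduced_join rp rr apart_sym.
elim=> [|n IHn] p q r.
  by case: p => // _ eu ev; exists [::], q, r; split=> //; case: (r).
case: (boolP (apart r p)) => [arp _ eu ev|]; first by exists p, q, r.
case: r p => [|a r] [|b p] //=; rewrite negbK => /eqP-> szp eu ev.
apply: (IHn p (inv_letter b :: q) r) => //.
  by rewrite eu word_inv_cons.
by rewrite ev word_inv_cons inv_letterK.
Qed.

End ReducedWords.

(** * Decomposition of words into syllables *)

Section Syllables.
Local Open Scope ring_scope.
Variable X : choiceType.
Local Notation letter := (X * bool)%type.
Local Notation syllables := (seq (X * int)).
Implicit Types (a : letter) (p q w : seq letter) (P Q S : syllables).

Definition letter_exp (e : bool) : int := if e then 1 else -1.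
Arguments letter_exp : simpl never.

Definition cons_letter a S : syllables :=
  if S is (y, n) :: S' then
    if y == a.1 then (y, n + letter_exp a.2) :: S'
    else (a.1, letter_exp a.2) :: S
  else [:: (a.1, letter_exp a.2)].

Definition syll w : syllables := foldr cons_letter [::] w.

Definition inv_syll S : syllables := rev [seq (s.1, - s.2) | s <- S].

Definition first_letter S (o : option letter) : option letter :=
  if S is (x, n) :: _ then Some (x, 0 < n) else o.

Lemma inv_syllK : involutive inv_syll.
Proof.
move=> S; rewrite /inv_syll map_rev revK -map_comp -[RHS]map_id.
by apply: eq_map => -[x n] /=; rewrite opprK.
Qed.

Lemma inv_syll_cons x n S : inv_syll ((x, n) :: S) = rcons (inv_syll S) (x, -
  n).
Proof. by rewrite /inv_syll /= rev_cons. Qed.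

Lemma first_letter_cat S1 S2 o :
  first_letter (S1 ++ S2) o = first_letter S1 (first_letter S2 o).
Proof. by case: S1. Qed.

(** Only the first syllables of the two legs can merge; that of [P] is traversed inwards, hence
    [m - n]. *)
Definition join_syll P Q : syllables :=
  match P, Q with
  | (x, n) :: P', (y, m) :: Q' =>
      if x == y then inv_syll P' ++ (x, m - n) :: Q' else inv_syll P ++ Q
  | _, _ => inv_syll P ++ Q
  end.

Lemma syll_join p q : syll (word_inv p ++ q) = join_syll (syll p) (syll q).
Proof.
elim: p q => [|a p IHp] q //; rewrite word_inv_cons IHp /=.
have expN : letter_exp (inv_letter a).2 = - letter_exp a.2.
  by rewrite /letter_exp /=; case: a.2; rewrite ?opprK.
rewrite /cons_letter !expN /=; clear expN.
case: (syll p) => [|[x n] P] /=.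
  case: (syll q) => [|[y m] Q] //=; rewrite [a.1 == y]eq_sym.
  by case: eqP => [->|].
case: (syll q) => [|[y m] Q] /=.
  rewrite [x == a.1]eq_sym; case: (eqVneq a.1 x) => [_|ne_ax] /=.
    by rewrite inv_syll_cons cats0 -cats1 opprD addrC.
  by rewrite (inv_syll_cons a.1) cats0 cats1.
case: (eqVneq x a.1) => [->|ne_xa]; case: (eqVneq y a.1) => [->|ne_ya] /=;
  rewrite ?eqxx /= ?[a.1 == y]eq_sym ?(negPf ne_ya) ?(negPf ne_xa) /=.
- by congr (_ ++ (_, _) :: _); lia.
- by rewrite inv_syll_cons cat_rcons opprD addrC.
- by [].
- by rewrite (inv_syll_cons a.1) cat_rcons.
Qed.

Lemma syll_inv w : syll (word_inv w) = inv_syll (syll w).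
Proof.
by rewrite -[word_inv w]cats0 syll_join; case: (syll w) => [|[x n] P];
  rewrite /= ?cats0.
Qed.

(** Adjacent letters of one generator have equal signs in a reduced word, so exponents never cancel.
    Together the two sign equations say that [n] is nonzero. *)
Lemma syll_cons a w : reduced (a :: w) -> exists n S,
  [/\ syll (a :: w) = (a.1, n) :: S, (0 < n) = a.2 & (0 < - n) = ~~ a.2].
Proof.
elim: w a => [|b w IHw] a; first by move=> _; exists (letter_exp a.2), [::];
  case: a => x [].
move=> /= /andP[ne_ba /IHw[n [S [/= -> n_gt0 n_lt0]]]] /=.
case: (eqVneq b.1 a.1) => [eq1|_]; last first.
  by exists (letter_exp a.2), ((b.1, n) :: S); case: a.2.
exists (n + letter_exp a.2), S; rewrite eq1.
have e2 : b.2 = a.2.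
  case: a b ne_ba eq1 {n_gt0 n_lt0 IHw} => [x d] [y e] /= + eyx.
  by rewrite eyx; case: d e => [] [] //=; rewrite eqxx.
by move: n_gt0 n_lt0; rewrite e2 /letter_exp; case: a.2 => /= n_gt0 n_lt0;
  split=> //; lia.
Qed.

End Syllables.

(** * Quasimorphisms counting syllables *)

Section SyllableCounting.
Local Open Scope ring_scope.
Variables (R : realType) (X : choiceType).
Local Notation letter := (X * bool)%type.
Local Notation syllables := (seq (X * int)).
Implicit Types (x y z : X) (n m k : int) (o : option letter) (P Q S :
  syllables).

(* A syllable x^n counts for [F x t n t'], where [t] and [t'] are the types,
   given by [ty x], of the two letters that leave it on its left (read
   backwards) and on its right; there is no such letter at an end of the word,
   and its type is then [false]. *)
Variables (F : X -> bool -> int -> bool -> R) (ty : X -> letter -> bool).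
Hypothesis F0 : forall x t t', F x t 0 t' = 0.
Hypothesis FN : forall x t n t', F x t (- n) t' = - F x t' n t.
Hypothesis F_triangle : forall x t1 t2 t3 n m,
  `|F x t1 n t2 + F x t2 m t3 - F x t1 (n + m) t3| <= 1.
Hypothesis ty_inj : forall x y a, ty x a -> ty y a -> x = y.
Hypothesis ty_eq0 : forall x a t n t', ty x a -> F a.1 t n t' = 0.

Definition otype x o : bool := if o is Some a then ty x a else false.

Fixpoint count_syll o S o' : R :=
  if S is (x, n) :: S' then
    F x (otype x o) n (otype x (first_letter _ S' o'))
      + count_syll (Some (x, 0 < - n)) S' o'
  else 0.

Lemma count_syll_cat o S1 S2 o' : count_syll o (S1 ++ S2) o' =
  count_syll o S1 (first_letter _ S2 o')
  + count_syll (first_letter _ (inv_syll _ S1) o) S2 o'.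
Proof.
elim: S1 o => [|[x n] S1 IHS] o /=; first by rewrite add0r.
by rewrite IHS addrA first_letter_cat inv_syll_cons -cats1 first_letter_cat.
Qed.

Lemma count_syll_inv o S o' :
  count_syll o' (inv_syll _ S) o = - count_syll o S o'.
Proof.
elim: S o => [|[x n] S IHS] o /=; first by rewrite oppr0.
rewrite inv_syll_cons -cats1 count_syll_cat /= IHS inv_syllK FN addr0.
by rewrite opprD addrC.
Qed.

(** The count of a path through the centre of a tripod is cut into what happens at the centre and
    the tails of two legs. Here [o] is the letter that faces the leg [S] across the centre. *)
Let head_count S o : R :=
  if S is (x, n) :: S' then F x (otype x o) n (otype x (first_letter _ S' None))
  else 0.

Let tail_count S : R :=
  if S is (x, n) :: S' then count_syll (Some (x, 0 < - n)) S' None else 0.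

Let join_count P Q : R :=
  match P, Q with
  | (x, n) :: P', (y, m) :: Q' =>
      if x == y then F x (otype x (first_letter _ P' None)) (m - n)
                         (otype x (first_letter _ Q' None))
      else head_count Q (first_letter _ P None)
           - head_count P (first_letter _ Q None)
  | _, _ => head_count Q (first_letter _ P None)
            - head_count P (first_letter _ Q None)
  end.

Let sapart P Q : bool :=
  match P, Q with
  | (x, n) :: _, (y, m) :: _ =>
    (x == y) ==> ((0 < n) && (0 < - m) || (0 < - n) && (0 < m))
  | _, _ => true
  end.

(** By [sapart] a merged exponent [m - n] has the sign of [m] and of [- n], so the tails see the
    same neighbouring letters as before the merging. *)
Lemma count_join P Q : sapart P Q ->
  count_syll None (join_syll _ P Q) None
  = join_count P Q + tail_count Q - tail_count P.
Proof.
have count_cat P1 Q1 : count_syll None (inv_syll _ P1 ++ Q1) None =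
    head_count Q1 (first_letter _ P1 None)
    - head_count P1 (first_letter _ Q1 None) + tail_count Q1 - tail_count P1.
  rewrite count_syll_cat count_syll_inv inv_syllK.
  by case: P1 Q1 => [|[x n] P1] [|[y m] Q1] /=; ring.
case: P Q => [|[x n] P] [|[y m] Q]; try by move=> _; apply: count_cat.
rewrite /=.
case: (eqVneq x y) => [-> /= sgn|_ _]; last by rewrite count_cat.
rewrite count_syll_cat count_syll_inv inv_syllK /=.
have -> : (0 < m - n) = (0 < m) by lia.
have -> : (0 < - (m - n)) = (0 < - m) by lia.
have -> : (0 < m) = (0 < - n) by lia.
by ring.
Qed.

Lemma F_type_change x t t' n u : `|F x t n u - F x t' n u| <= 1.
Proof.
by have := F_triangle x t' t u 0 n; rewrite F0 add0r add0r.
Qed.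

Lemma head_count_change P o o' : `|head_count P o - head_count P o'| <= 1.
Proof. by case: P => [|[x n] P] /=; rewrite ?subrr ?normr0 ?F_type_change. Qed.

Let hd P := if P is (x, _) :: _ then Some x else None.

Lemma join_count_neq P Q : (hd P != hd Q) || (hd P == None) ->
  join_count P Q = head_count Q (first_letter _ P None)
                   - head_count P (first_letter _ Q None).
Proof.
case: P Q => [|[x n] P] [|[y m] Q] //=.
by rewrite orbF; case: (eqVneq x y) => [->|_ _] //; rewrite eqxx.
Qed.

(** A difference can only come from the type of the facing letter. The nonzero weight is recorded
    because it contradicts [ty_eq0] if the generator of [P] also supplies a letter of type
    [true]. *)
Lemma head_count_neq P Q S :
  head_count P (first_letter _ Q None) != head_count P (first_letter _ S None)
    ->
  exists2 x, hd P = Some x & 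
    (exists t n t', F x t n t' != 0) /\
    ((exists2 a, first_letter _ Q None = Some a & ty x a) \/
    (exists2 a, first_letter _ S None = Some a & ty x a)).
Proof.
case: P => [|[x n] P] /=; first by rewrite eqxx.
move=> ne; exists x => //; split.
  case: (eqVneq (F x (otype x (first_letter _ Q None)) n
         (otype x (first_letter _ P None))) 0) => [e0|]; last by move=> ne0;
           do 3!eexists; exact: ne0.
  by move: ne; rewrite e0 eq_sym; move=> ne0; do 3!eexists; exact: ne0.
case: (first_letter _ Q None) ne => [a|];
  case: (first_letter _ S None) => [b|] /=.
- case tya: (ty x a); first by move=> _; left; exists a.
  by case tyb: (ty x b); [move=> _; right; exists b | rewrite eqxx].
- by case tya: (ty x a); [move=> _; left; exists a | rewrite eqxx].
- by case tyb: (ty x b); [move=> _; right; exists b | rewrite eqxx].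
- by rewrite eqxx.
Qed.

Lemma first_letter_hd P a : first_letter _ P None = Some a -> hd P = Some a.1.
Proof. by case: P => [|[x n] P] //= [<-]. Qed.

(* At the centre of a tripod, the context of the first syllable of a leg
   differs for the two other legs only if exactly one of them starts with the
   letter of type [true]; this happens for at most one leg. *)
Lemma head_count_excl P Q S :
  (hd P != hd Q) || (hd P == None) ->
  head_count P (first_letter _ Q None) != head_count P (first_letter _ S None)
    ->
  head_count Q (first_letter _ S None) = head_count Q (first_letter _ P None).
Proof.
move=> nePQ /head_count_neq[x hdP [[t [n [t' Fx]]] tyP]].
apply/eqP/negP => /negP /head_count_neq[y hdQ [[u [m [u' Fy]]] tyQ]].
case: tyP => -[a fa tya].
  by move: Fy; have := first_letter_hd _ _ fa; rewrite hdQ => -[->];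
    rewrite (ty_eq0 _ _ _ _ _ tya) eqxx.
case: tyQ => -[b fb tyb]; last first.
  by move: Fx; have := first_letter_hd _ _ fb; rewrite hdP => -[->];
    rewrite (ty_eq0 _ _ _ _ _ tyb) eqxx.
move: fb nePQ; rewrite fa hdP hdQ => -[ab]; rewrite -ab in tyb.
by rewrite (ty_inj _ _ _ tya tyb) eqxx.
Qed.

(** If [S] counts equally towards [P] and [Q], its two terms cancel and [F_triangle] for [x]
    remains. *)
Lemma join_count_same P Q S x : hd P = Some x -> hd Q = Some x ->
  hd S != Some x ->
  `|join_count P Q + join_count Q S + join_count S P| <= 1.
Proof.
case: P Q => [|[x1 n] P] [|[x2 m] Q] // [->] [->] hdS.
rewrite (join_count_neq S) ?hdS // (join_count_neq _ S) 1?[_ == hd S]eq_sym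
  ?hdS //.
rewrite /= eqxx; set t := otype x _; set u := otype x _; set s := otype x _.
set hQ := head_count S (Some (x, 0 < m));
  set hP := head_count S (Some (x, 0 < n)).
case: (eqVneq hQ hP) => [->|].
  have := F_triangle x s t u n (m - n); rewrite (addrC n) subrK;
    congr (`|_| <= 1).
  by ring.
(* Otherwise a letter of [x] has type [true] for the generator of [S], so all weights of [x] vanish
   and only the change at [S] remains. *)
move=> /(head_count_neq S ((x, m) :: Q) ((x, n) :: P))[z _ [_ tyz]].
have Fx0 v k v' : F x v k v' = 0.
  by case: tyz => -[a [<-] tya]; apply: ty_eq0 tya.
rewrite !Fx0; have := head_count_change S (Some (x, 0 < m)) (Some (x, 0 < n)).
by congr (`|_| <= 1); rewrite -/hQ -/hP; ring.
Qed.

(** Three legs cannot share their first generator, as there are only two signs. If two legs do,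
    [join_count_same] applies up to rotation. Otherwise the head counts form one difference per leg,
    each at most 1 in absolute value, and by [head_count_excl] at most one of them is nonzero. *)
Lemma join_count_cycle P Q S : sapart P Q -> sapart Q S -> sapart S P ->
  `|join_count P Q + join_count Q S + join_count S P| <= 1.
Proof.
have same P1 P2 P3 : sapart P1 P2 -> sapart P2 P3 -> sapart P3 P1 ->
    ~~ ((hd P1 != hd P2) || (hd P1 == None)) ->
    `|join_count P1 P2 + join_count P2 P3 + join_count P3 P1| <= 1.
  case: P1 P2 P3 => [|[x1 n1] P1] [|[x2 n2] P2] P3 // a12 a23 a31.
  rewrite [hd _]/= [hd (_ :: P2)]/= orbF negbK => /eqP[e12];
    rewrite -e12 in a12 a23 *.
  apply: (join_count_same _ _ _ x1) => //.
  case: P3 a23 a31 => [|[x3 n3] P3] //= a23 a31.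
  by apply/eqP => -[e3]; move: a12 a23 a31; rewrite e3 /= !eqxx /=; lia.
move=> aPQ aQS aSP.
have [neqPQ|/same] := boolP ((hd P != hd Q) || (hd P == None)); last exact.
have [neqQS|/same H] := boolP ((hd Q != hd S) || (hd Q == None)); last first.
  by rewrite -addrA addrC; apply: H.
have [neqSP|/same H] := boolP ((hd S != hd P) || (hd S == None)); last first.
  by rewrite addrC addrA; apply: H.
have sym P1 P2 : (hd P1 != hd P2) || (hd P1 == None) -> (hd P2 != hd P1) || (hd
  P2 == None).
  by rewrite eq_sym; case: eqP => [->|].
rewrite !join_count_neq //.
have exPQ := head_count_excl P Q S neqPQ.
have exPS := head_count_excl P S Q (sym _ _ neqSP).
have exQS := head_count_excl Q S P neqQS.
have exQP := head_count_excl Q P S (sym _ _ neqPQ).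
have := head_count_change P (first_letter _ S None) (first_letter _ Q None).
have := head_count_change Q (first_letter _ P None) (first_letter _ S None).
have := head_count_change S (first_letter _ Q None) (first_letter _ P None).
move: exPQ exPS exQS exQP.
set pq := head_count P (first_letter _ Q None); set ps := head_count P _.
set qp := head_count Q (first_letter _ P None); set qs := head_count Q _.
set sp := head_count S (first_letter _ P None); set sq := head_count S _.
case: (eqVneq pq ps) => [<- _ _|ne /(_ isT) e1 /(_ _) e2] exQS exQP.
  case: (eqVneq qs qp) exQS => [-> _|ne /(_ isT) -> _].
    by move=> + _ _; congr (`|_| <= 1); ring.
  by move=> + _; congr (`|_| <= 1); ring.
move=> _ _; rewrite e1 e2 1?eq_sym //; congr (`|_| <= 1); ring.
Qed.

Definition count_word (w : seq letter) : R := count_syll None (syll _ w) None.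

Lemma count_word_inv w : count_word (word_inv w) = - count_word w.
Proof. by rewrite /count_word syll_inv count_syll_inv. Qed.

Lemma sapart_syll p q : reduced p -> reduced q -> apart _ p q ->
  sapart (syll _ p) (syll _ q).
Proof.
case: p q => [|a p] [|b q] // rp rq; first by case: (syll _ _) => [|[]].
have [n [P [-> n1 n2]]] := syll_cons _ _ _ rp.
have [m [Q [-> m1 m2]]] := syll_cons _ _ _ rq.
rewrite /= n1 n2 m1 m2; case: a b {rp rq n1 n2 m1 m2} => [x d] [y e] /=.
by case: (eqVneq x y) => [->|] //=; case: d e => [] [] //=; rewrite eqxx.
Qed.

(** The words [u], [v] and the inverse of their product run once around the tripod. Each tail occurs
    with both signs, so only the junctions contribute. *)
Lemma count_word_quasi (u v : seq letter) : reduced u -> reduced v ->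
  `|count_word u + count_word v - count_word (word_mul u v)| <= 1.
Proof.
move=> ru rv; have [p [q [r [/and3P[rp rq rr]]]]] := tripod_split _ _ _ ru rv.
move=> /and3P[apq aqr arp] -> -> ->.
rewrite -count_word_inv.
have -> : word_inv (word_inv p ++ r) = word_inv r ++ p.
  by rewrite /word_inv map_cat rev_cat -!/(word_inv _) word_invK.
rewrite /count_word !syll_join !count_join ?sapart_syll //.
have := join_count_cycle _ _ _ (sapart_syll _ _ rp rq apq)
  (sapart_syll _ _ rq rr aqr) (sapart_syll _ _ rr rp arp).
by congr (`|_| <= 1); ring.
Qed.

Definition count_free (g : free_group X) : R := count_word (val g).

Lemma count_freeV g : count_free g^-1%g = - count_free g.
Proof. exact: count_word_inv. Qed.

Lemma count_freeM g h : `|count_free g + count_free h - count_free (g * h)%g|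
  <= 1.
Proof. exact: count_word_quasi (valP g) (valP h). Qed.

End SyllableCounting.

(** * The weights *)

Section Weights.
Local Open Scope ring_scope.
Variables (R : realType) (X : choiceType) (rho : X -> nat).
Hypothesis rho_inj : injective rho.
Variable q : nat -> nat.
Local Notation letter := (X * bool)%type.
Implicit Types (n m : int).

(** The sign of [r] minus twice the truncation of [r] to the interval from -1 to 1. *)
Definition ramp (r : R) : R :=
  if r == 0 then 0 else if 0 < r then (if r < 1 then 1 - 2 * r else - 1)
  else (if - 1 < r then - 1 - 2 * r else 1).

Lemma rampN (r : R) : ramp (- r) = - ramp r.
Proof.
rewrite /ramp oppr_eq0 oppr_gt0 ltrN2.
have -> : (- r < 1) = (- 1 < r) by rewrite ltrNl.
case: (ltgtP r 0) => [r0|r0|_]; rewrite ?oppr0 //; case: ifP; lra.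
Qed.

Lemma ramp_le1 (r : R) : `|ramp r| <= 1.
Proof.
rewrite /ramp ler_norml.
case: (ltgtP r 0) => [r0|r0|_]; last lra; case: ifPn; rewrite -?leNgt; lra.
Qed.

Lemma ramp_triangle (x y : R) : `|ramp x + ramp y - ramp (x + y)| <= 1.
Proof.
rewrite /ramp ler_norml.
case: (ltgtP x 0) => [x0|x0|->]; case: (ltgtP y 0) => [y0|y0|->];
  rewrite ?add0r ?addr0;
  repeat (case: ifPn; rewrite -?leNgt); lra.
Qed.

Lemma sgr_le1 (r : R) : `|Num.sg r| <= 1.
Proof. by rewrite normr_sg lern1; case: (_ != _). Qed.

Lemma sgr_triangle (x y : R) : `|Num.sg x + Num.sg y - Num.sg (x + y)| <= 1.
Proof.
rewrite ler_norml; case: (sgrP x) => x0; case: (sgrP y) => y0;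
  case: (sgrP (x + y)) => xy0; lra.
Qed.

(* The generators numbered 0, 2i+1, 2i+2 play the roles of c, b_i, a_i. *)
Definition weight (x : X) (t : bool) n (t' : bool) : R :=
  if (odd (rho x) || (rho x == 0%N)) && (t == t') then
    if t then ramp (n%:~R / (q (rho x)./2).+3%:R) else Num.sg n%:~R
  else 0.

(** For b_i the only letter of type [true] is the inverse of a_i. As left neighbours are read
    backwards, both types are [true] exactly for syllables between a_i and its inverse. *)
Definition weight_type (x : X) (a : letter) : bool :=
  [&& odd (rho x), rho a.1 == (rho x).+1 & ~~ a.2].

Lemma weight0 x t t' : weight x t 0 t' = 0.
Proof.
by rewrite /weight mul0r sgr0 /ramp eqxx; case: ifP => //; case: ifP.
Qed.

Lemma weightN x t n t' : weight x t (- n) t' = - weight x t' n t.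
Proof.
rewrite /weight mulrNz mulNr sgrN rampN [t == t']eq_sym.
case: ifP => [/andP[_ /eqP->]|]; last by rewrite oppr0.
by case: ifP.
Qed.

(** If the three types agree, this is the inequality for [ramp] or the sign. If not, exactly one
    pair of types agrees, and the single surviving term is at most 1 in absolute value. *)
Lemma weight_triangle x t1 t2 t3 n m :
  `|weight x t1 n t2 + weight x t2 m t3 - weight x t1 (n + m) t3| <= 1.
Proof.
rewrite /weight; case: (_ || _); last by rewrite addr0 subr0 normr0.
rewrite intrD mulrDl.
by case: t1 t2 t3 => [] [] [] /=; rewrite ?addr0 ?subr0 ?add0r ?normrN
  ?ramp_triangle ?sgr_triangle ?ramp_le1 ?sgr_le1.
Qed.

Lemma weight_type_inj x y a : weight_type x a -> weight_type y a -> x = y.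
Proof.
move=> /and3P[_ /eqP e1 _] /and3P[_ /eqP e2 _].
by apply: rho_inj; move: e2; rewrite e1 => -[].
Qed.

Lemma weight_type_eq0 x a t n t' : weight_type x a -> weight a.1 t n t' = 0.
Proof. by move=> /and3P[ox /eqP ea _]; rewrite /weight ea /= ox. Qed.

Lemma weight_a x t n t' : ~~ odd (rho x) -> rho x != 0%N -> weight x t n t' = 0.
Proof. by move=> /negPf ox /negPf x0; rewrite /weight ox x0. Qed.

Let count := count_syll R X weight weight_type.

Definition block_syll (b a : X) (k : nat) : seq (X * int) :=
  [:: (b, 1); (a, 1); (b, - k.+3%:Z); (a, -1); (b, 1); (a, 1); (b, 1); (a, -1);
      (b, k%:Z)].

(** With p = q_i + 3: three of the five syllables of [b] have type [false] on both sides and count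
    1. Between [a] and its inverse, b^-p counts [ramp] of -1, which is 1, and [b] counts [ramp] of
    1/p, which is 1 - 2/p. *)
Lemma count_block i b a S o o' : rho b = i.*2.+1 -> rho a = i.*2.+2 ->
  (0 < q i)%N -> otype X weight_type b o = false ->
  otype X weight_type b (first_letter _ S o') = false ->
  count o (block_syll b a (q i) ++ S) o' =
  5 - 2 / (q i).+3%:R + count (Some (b, false)) S o'.
Proof.
move=> rb ra q0 ob ob'.
have wa t n t' : weight a t n t' = 0 by apply: weight_a;
  rewrite ra /= ?odd_double.
have tyT e : weight_type b (a, e) = ~~ e.
  by rewrite /weight_type /= rb ra /= odd_double eqxx.
have rb2 : (rho b)./2 = i by rewrite rb /= uphalf_double.
have wb t n : weight b t n t =
    if t then ramp (n%:~R / (q i).+3%:R) else Num.sg n%:~R.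
  by rewrite /weight rb2 rb /= odd_double eqxx.
have p0 : (q i).+3%:R != 0 :> R by rewrite pnatr_eq0.
rewrite /count /= !wa ob ob' !tyT !wb ?addr0 ?add0r.
have -> : (0 < - (q i)%:Z) = false by lia.
have -> : Num.sg (q i)%:~R = 1 :> R by rewrite gtr0_sg // ltr0z ltz_nat.
have -> : ramp ((- (q i).+3%:Z)%:~R / (q i).+3%:R) = 1.
  by rewrite mulrNz mulNr divff // /ramp oppr_eq0 oner_eq0 oppr_gt0 ltr10 ltxx.
have -> : ramp (1%:~R / (q i).+3%:R) = 1 - 2 / (q i).+3%:R.
  rewrite div1r /ramp invr_eq0 (negPf p0) invr_gt0 ltr0n /=.
  by rewrite invf_lt1 ?ltr0n // ltr1n.
by rewrite sgr1 /=; ring.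
Qed.

End Weights.

(** * Group elements spelled by syllables *)

Section SyllableWords.
Local Open Scope ring_scope.
Variable X : choiceType.
Implicit Types (x : X) (g h : free_group X) (S T : seq (X * int)).

Definition letter_elt (a : X * bool) : free_group X := exist _ [:: a] isT.

Lemma letter_eltN x : letter_elt (x, false) = (letter_elt (x, true))^-1%g.
Proof. exact/val_inj. Qed.

Definition head_gen S : option X := ohead [seq s.1 | s <- S].

Lemma syll_letter_elt_mul (a : X * bool) g :
  first_letter _ (syll _ (val g)) None != Some (inv_letter a) ->
  syll _ (val (letter_elt a * g)%g) = cons_letter _ a (syll _ (val g)).
Proof.
have -> : val (letter_elt a * g)%g = push a (val g) by [].
case: g => -[|b w] rw //=.
have [n [S [eS n_gt0 _]]] := syll_cons _ _ _ rw.
rewrite -/(cons_letter _ b _) -[cons_letter _ b _]/(syll _ (b :: w)) eS /=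
  n_gt0.
rewrite -surjective_pairing; case: (eqVneq b (inv_letter a)) => [->|_ _].
  by rewrite eqxx.
by rewrite -[syll _ (a :: _)]/(cons_letter _ a (syll _ (b :: w))) eS.
Qed.

Lemma syll_letter_elt_exp (a : X * bool) k g S :
  syll _ (val g) = S -> head_gen S != Some a.1 ->
  syll _ (val (letter_elt a ^+ k.+1 * g)%g) = (a.1, letter_exp a.2 *+ k.+1) ::
    S.
Proof.
move=> gS hS; elim: k => [|k IHk].
  rewrite expg1 syll_letter_elt_mul gS.
    case: S hS {gS} => [|[y n] S] //= /eqP neq; case: eqP => // e.
    by case: neq; rewrite e.
  case: S hS {gS} => [|[y n] S] //=; move=> hS; apply/eqP => -[e _].
  by case/eqP: hS; rewrite e.
rewrite expgS -mulgA syll_letter_elt_mul IHk /=; first by rewrite eqxx -mulrSr.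
by apply/eqP => -[]; case: (a.2); rewrite /letter_exp /=; lia.
Qed.

Definition gen_exp (s : X * int) : free_group X :=
  (letter_elt (s.1, (0 < s.2)) ^+ absz s.2)%g.

Definition syll_elt S : free_group X := (\prod_(s <- S) gen_exp s)%g.

Definition spells g S := syll _ (val g) = S.

Lemma spells_cons x n g S : n != 0 -> spells g S -> head_gen S != Some x ->
  spells (gen_exp (x, n) * g)%g ((x, n) :: S).
Proof.
move=> n0 gS hS; rewrite /spells /gen_exp.
case def_k: (absz n) n0 => [|k] n0; first by lia.
rewrite /= (syll_letter_elt_exp (x, 0 < n) k _ _ gS hS) /letter_exp /=.
by congr ((_, _) :: _); case: ifP => n_gt0; lia.
Qed.

Lemma gen_exp_nat x k : gen_exp (x, k%:Z) = (letter_elt (x, true) ^+ k)%g.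
Proof. by case: k => [|k]. Qed.

Lemma gen_expN_nat x k : gen_exp (x, - k%:Z) = ((letter_elt (x, true) ^+
  k)^-1)%g.
Proof.
by case: k => [|k]; rewrite /gen_exp /= ?invg1 // letter_eltN expVgn.
Qed.

Lemma syll_elt_cons s S : syll_elt (s :: S) = (gen_exp s * syll_elt S)%g.
Proof. by rewrite /syll_elt big_cons. Qed.

Lemma syll_elt_cat S T : syll_elt (S ++ T) = (syll_elt S * syll_elt T)%g.
Proof. by rewrite /syll_elt big_cat. Qed.

Lemma block_syll_elt (b a : X) k :
  syll_elt (block_syll X b a k)
  = block _ (letter_elt (a, true)) (letter_elt (b, true)) k.
Proof.
rewrite /syll_elt /block_syll !big_cons big_nil.
rewrite !(gen_exp_nat _ 1) !(gen_expN_nat _ 1) gen_exp_nat gen_expN_nat.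
by rewrite /block !expg1 mulg1 !mulgA.
Qed.

Lemma spells_syll_cons x n g S T : n != 0 -> spells (syll_elt S * g)%g T ->
  head_gen T != Some x -> spells (syll_elt ((x, n) :: S) * g)%g ((x, n) :: T).
Proof. by move=> *; rewrite syll_elt_cons -mulgA; apply: spells_cons. Qed.

End SyllableWords.

(** * Chains of blocks *)

Section BlockChains.
Local Open Scope ring_scope.
Variables (R : realType) (X : choiceType) (rho : X -> nat).
Hypothesis rho_inj : injective rho.
Variables (q : nat -> nat) (b a : nat -> X) (c : X) (M : nat).
Hypothesis q_gt0 : forall i, (0 < q i)%N.
Hypothesis rho_c : rho c = 0%N.
Hypothesis rho_b : forall i, (i < M)%N -> rho (b i) = i.*2.+1.
Hypothesis rho_a : forall i, (i < M)%N -> rho (a i) = i.*2.+2.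
Implicit Types (s : seq nat) (T : seq (X * int)) (i j k : nat).

Local Notation elt x := (letter_elt X (x, true)).
Local Notation blk i := (block_syll X (b i) (a i) (q i)).

Fixpoint block_chain i s : free_group X :=
  let u := block _ (elt (a i)) (elt (b i)) (q i) in
  (if s is j :: s' then u * block_chain j s' ^ (elt c)^-1 else u)%g.

(** The closing exponent [k] stays fixed while the recursion consumes blocks; for [k = size s] at
    the top it closes the nested conjugations of [block_chain]. *)
Fixpoint chain_syll i s k : seq (X * int) :=
  blk i ++ (if s is j :: s' then (c, 1) :: chain_syll j s' k
            else [:: (c, - k%:Z)]).

Lemma chain_syllE i s k :
  chain_syll i s k = blk i ++ (if s is j :: s' then (c, 1) :: chain_syll j s' k
            else [:: (c, - k%:Z)]).
Proof. by case: s. Qed.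

Lemma chain_syll_elt i s k : syll_elt X (chain_syll i s k)
  = (block_chain i s * elt c ^+ size s / elt c ^+ k)%g.
Proof.
elim: s i => [|j s IHs] i; rewrite chain_syllE syll_elt_cat block_syll_elt
  syll_elt_cons.
  by rewrite gen_expN_nat /syll_elt big_nil !mulg1.
rewrite (gen_exp_nat _ _ 1) expg1 IHs /= expgS conjgE invgK.
by rewrite !(mulgA, mulgVK, mulgK).
Qed.

Lemma spells_block i g T : (i < M)%N -> spells X g T ->
  head_gen X T != Some (b i) -> spells X (syll_elt X (blk i) * g)%g (blk i ++
    T).
Proof.
move=> iM gT hT.
have ab : a i != b i.
  by apply: contraTneq isT => ab; have := rho_b _ iM; rewrite -ab rho_a //; lia.
have ba : b i != a i by rewrite eq_sym.
do 9!(apply: spells_syll_cons;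
  [by rewrite ?oppr_eq0 ?eqz_nat -?lt0n | | first [exact: hT | exact: ab |
    exact: ba]]).
by rewrite /syll_elt big_nil mul1g.
Qed.

Lemma spells_chain i s k g T : (0 < k)%N -> {in i :: s, forall j, (j < M)%N} ->
  spells X g T -> head_gen X T != Some c ->
  spells X (syll_elt X (chain_syll i s k) * g)%g (chain_syll i s k ++ T).
Proof.
move=> k0 + gT hT.
have cb j : (j < M)%N -> Some c != Some (b j).
  by move=> jM; apply/eqP => -[cb]; have := rho_b _ jM; rewrite -cb rho_c.
elim: s i => [|j s IHs] i ltM; rewrite chain_syllE syll_elt_cat -catA -mulgA.
  have iM : (i < M)%N by apply: ltM; rewrite mem_head.
  apply: spells_block => //; last by rewrite cb.
  apply: spells_syll_cons => //; first by rewrite oppr_eq0 eqz_nat -lt0n.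
  by rewrite /syll_elt big_nil mul1g.
have iM : (i < M)%N by apply: ltM; rewrite mem_head.
have jM : (j < M)%N by apply: ltM; rewrite !inE eqxx orbT.
apply: spells_block => //; last by rewrite cb.
apply: spells_syll_cons => //.
  by apply: IHs => l ls; apply: ltM; rewrite in_cons ls orbT.
by rewrite chain_syllE eq_sym cb.
Qed.

Let w := weight R X rho q.
Let wty := weight_type X rho.
Let count := count_syll R X w wty.

Let neutral (o : option (X * bool)) :=
  forall i, (i < M)%N -> otype X wty (b i) o = false.

Let neutral_c e : neutral (Some (c, e)).
Proof. by move=> i iM; rewrite /= /wty /weight_type /= rho_c rho_b // andbF.
  Qed.

Let otype_c o : otype X wty c o = false.
Proof. by case: o => //= x; rewrite /wty /weight_type rho_c. Qed.

Let count_c n o T o' : n != 0 ->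
  count o ((c, n) :: T) o' = Num.sg n%:~R + count (Some (c, 0 < - n)) T o'.
Proof. by move=> n0; rewrite /count /= !otype_c {1}/w /weight rho_c. Qed.

(** Each connecting [c] counts 1, while the closing power of [c] counts only -1, however large [k]
    is. *)
Lemma count_chain i s k o T o' : (0 < k)%N -> neutral o ->
  {in i :: s, forall j, (j < M)%N} ->
  count o (chain_syll i s k ++ T) o' =
  \sum_(j <- i :: s) (5 - 2 / (q j).+3%:R) + (size s)%:R - 1
  + count (Some (c, true)) T o'.
Proof.
move=> k0; elim: s i o => [|j s IHs] i o no ltM; rewrite chain_syllE -catA;
  have iM : (i < M)%N by (apply: ltM; rewrite mem_head).
  rewrite [LHS](count_block _ _ _ _ i) ?rho_a ?rho_b //;
    [|exact: no|exact: neutral_c].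
  rewrite -/w -/wty -/count count_c ?oppr_eq0 ?eqz_nat -?lt0n // opprK ltz_nat
    k0.
  by rewrite mulrNz ltr0_sg ?oppr_lt0 ?ltr0z ?ltz_nat // big_seq1 /=; ring.
have jM : (j < M)%N by apply: ltM; rewrite !inE eqxx orbT.
rewrite [LHS](count_block _ _ _ _ i) ?rho_a ?rho_b //;
  [|exact: no|exact: neutral_c].
rewrite -/w -/wty -/count count_c // IHs; first 1 last.
- exact: neutral_c.
- by move=> l ls; apply: ltM; rewrite in_cons ls orbT.
have -> : (size (j :: s))%:R = (size s)%:R + 1 :> R by rewrite natr1.
by rewrite sgr1 [\sum_(_ <- _ :: _ :: _) _]big_cons; ring.
Qed.

Variables (i0 i1 : nat) (s : seq nat).
Hypothesis ltM : {in [:: i0, i1 & s], forall j, (j < M)%N}.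
Let g := block_chain i0 (i1 :: s).
Let S := chain_syll i0 (i1 :: s) (size s).+1.

Let gS : syll_elt X S = g.
Proof. by rewrite chain_syll_elt mulgK. Qed.

(** With at least two blocks the closing power of [c] is nontrivial and separates consecutive copies
    of [S], so nothing cancels or merges. *)
Let spells_pow N : spells X (g ^+ N)%g (flatten (nseq N S)).
Proof.
elim: N => [|N IHN] //; rewrite expgS -gS; apply: spells_chain => //.
  by rewrite gS.
case: N {IHN} => [|N] //=; rewrite chain_syllE; apply/eqP => -[bc].
by have := rho_b i0 (ltM _ (mem_head _ _)); rewrite bc rho_c.
Qed.

Lemma count_chain_pow N : count_free R X w wty (g ^+ N)%g =
  (\sum_(j <- [:: i0, i1 & s]) (5 - 2 / (q j).+3%:R) + (size s)%:R) * N%:R.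
Proof.
rewrite /count_free /count_word spells_pow -/count.
suff H o : neutral o -> count o (flatten (nseq N S)) None =
  (\sum_(j <- [:: i0, i1 & s]) (5 - 2 / (q j).+3%:R) + (size s)%:R) * N%:R.
  exact: H.
elim: N o => [|N IHN] o no; first by rewrite mulr0.
rewrite -[flatten _]/(S ++ flatten (nseq N S)) count_chain // IHN;
  last exact: neutral_c.
have -> : (size (i1 :: s))%:R = (size s)%:R + 1 :> R by rewrite natr1.
have -> : N.+1%:R = N%:R + 1 :> R by rewrite natr1.
by ring.
Qed.

Lemma cl_upper_chain i r : cl_upper R _ (block_chain i r)
  (\sum_(j <- i :: r) (1 - (2 * (q j).+3%:R)^-1) + (size r)%:R / 2).
Proof.
elim: r i => [|j r IHr] i /=.
  by rewrite big_seq1 mul0r addr0; apply: cl_upper_block.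
have := cl_upperM R _ _ _ _ _ (cl_upper_block R _ (elt (a i)) (elt (b i)) (q i))
  (cl_upperJ R _ _ (elt c)^-1%g _ (IHr j)).
rewrite [in X in _ -> X]big_cons; congr cl_upper.
have -> : (size r).+1%:R = (size r)%:R + 1 :> R by rewrite natr1.
by field.
Qed.

(** For k + 1 blocks the quasimorphism has slope k - 1 plus the sum of the 5 - 2/p_j. A quarter of
    this is exactly the upper bound of [cl_upper_chain]. *)
Lemma scl_block_chain : scl R g =
  \sum_(j <- [:: i0, i1 & s]) (1 - (2 * (q j).+3%:R)^-1) + (size s).+1%:R / 2.
Proof.
apply: scl_eq; first exact: cl_upper_chain.
have -> : \sum_(j <- [:: i0, i1 & s]) (1 - (2 * (q j).+3%:R)^-1) + (size
  s).+1%:R / 2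
  = (\sum_(j <- [:: i0, i1 & s]) (5 - 2 / (q j).+3%:R) + (size s)%:R) / 4 :> R.
  have H (r : seq nat) : \sum_(j <- r) (1 - (2 * (q j).+3%:R)^-1)
      = (\sum_(j <- r) (5 - 2 / (q j).+3%:R) - (size r)%:R) / 4 :> R.
    elim: r => [|j r IHr]; first by rewrite !big_nil subr0 mul0r.
    have -> : (size (j :: r))%:R = (size r)%:R + 1 :> R by rewrite natr1.
    rewrite !big_cons IHr invfM; move: ((q j).+3%:R^-1) (\sum_(_ <- r) _) => x
      y.
    by field.
  rewrite H.
  have -> : (size [:: i0, i1 & s])%:R = (size s)%:R + 2 :> R by rewrite -natrD
    addn2.
  have -> : (size s).+1%:R = (size s)%:R + 1 :> R by rewrite natr1.
  by field.
apply: (quasimorphism_cl_lower R _ (count_free R X w wty) _ _ g _ 0) =>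
  [h|h h'|].
- apply: count_freeV => *; exact: weightN.
- apply: count_freeM => *; first exact: weight0; first exact: weightN.
  + exact: weight_triangle.
  + by apply: weight_type_inj; eassumption.
  + by apply: weight_type_eq0; eassumption.
- by move=> N; rewrite count_chain_pow subr0 lexx.
Qed.

Lemma derived_block_chain : derived_subgroup g.
Proof.
suff [k gk] : exists k, commutator_product g k.
  exact: commutator_product_derived gk.
rewrite /g; elim: (i1 :: s) i0 => [|j r IHr] i /=.
  exact: commutator_product_block.
have [k uk] := commutator_product_block _ (elt (a i)) (elt (b i)) (q i).
have [l vl] := IHr j; exists (k + l)%N.
exact/commutator_productM/commutator_productJ.
Qed.

End BlockChains.

(** * The lexicographic order *)

Section LexicographicOrder.
Implicit Types (f g : nat -> nat) (m i : nat).

Definition vanish_from m f := forall i, (m <= i)%N -> f i = 0%N.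

Definition level f : nat :=
  xget 0%N [set m | vanish_from m f /\ (m = 0%N \/ f m.-1 <> 0%N)].

Lemma levelP {m f} : vanish_from m f ->
  vanish_from (level f) f /\ (level f = 0%N \/ f (level f).-1 <> 0%N).
Proof.
move=> mf; apply: (@xgetPex _ _ [set m | vanish_from m f /\ (m = 0%N \/ f m.-1
  <> 0%N)]).
elim: m mf => [|m IHm] mf; first by exists 0%N; split=> //; left.
case: (eqVneq (f m) 0%N) => [fm0|/eqP fm0]; last by exists m.+1; split=> //;
  right.
by apply: IHm => i; rewrite leq_eqVlt => /predU1P[<-|/mf].
Qed.

Lemma level_le m f : vanish_from m f -> (level f <= m)%N.
Proof.
move=> mf; have [_ [->//|f0]] := levelP mf; rewrite leqNgt; apply/negP => m_lt.
by apply: f0; apply: mf; rewrite -ltnS (ltn_predK m_lt).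
Qed.

Lemma omega_pow_vanish f : omega_pow nat f <-> exists m, vanish_from m f.
Proof.
split=> [|[m mf]]; last first.
  apply: (sub_finite_set _ (finite_II m)) => i /= fi0.
  by rewrite ltnNge; apply/negP => /mf fi; rewrite fi in fi0.
move=> /finite_seqP[A eA]; exists (\max_(i <- A) i).+1 => i le_i.
apply/eqP; apply: contraTT le_i => fi0; rewrite -ltnNge ltnS.
have iA : i \in A by have : [set b | f b != 0%N] i by []; rewrite eA.
exact: (@leq_bigmax_seq _ A xpredT id i iA isT).
Qed.

Local Notation lex := (@omega_pow_lt _ nat).

(** The value at the highest index where members of [D] may differ is minimised first; induction
    then applies to the members attaining it. *)
Lemma lex_min_eventually_eq m (D : set (nat -> nat)) f0 : D f0 ->
  (forall f g, D f -> D g -> forall i, (m <= i)%N -> f i = g i) ->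
  exists2 f, D f & forall g, D g -> f = g \/ lex f g.
Proof.
elim: m D f0 => [|m IHm] D f0 Df0 eqD.
  exists f0 => // g Dg; left; apply/funext => i; exact: eqD.
have [|v /asboolP[f1 Df1 f1v] minv] := @ex_minnP (fun v =>
  `[< exists2 f, D f & f m = v >]).
  by exists (f0 m); apply/asboolP; exists f0.
have [||f [Df fv] minf] := IHm [set f | D f /\ f m = v] f1.
- by [].
- move=> f g [Df fv] [Dg gv] i; rewrite leq_eqVlt => /predU1P[<-|];
  last exact: eqD.
  by rewrite fv gv.
exists f => // g Dg; have /minv : `[< exists2 f, D f & f m = g m >].
  by apply/asboolP; exists g.
rewrite leq_eqVlt => /predU1P[vg|v_lt]; first exact: minf.
right; exists m; rewrite fv; split=> // i; exact: eqD.
Qed.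

(** The bound [m] of the support is minimised first. A member that does not vanish from [m] on is
    larger at its last nonzero index. *)
Lemma lex_min (D : set (nat -> nat)) f0 : D f0 -> D `<=` omega_pow nat ->
  exists2 f, D f & forall g, D g -> f = g \/ lex f g.
Proof.
move=> Df0 fsD.
have [|m /asboolP[f1 Df1 mf1] minm] :=
    @ex_minnP (fun m => `[< exists2 f, D f & vanish_from m f >]).
  by have /fsD/omega_pow_vanish[m mf0] := Df0; exists m; apply/asboolP;
    exists f0.
have [||f [Df mf] minf] := @lex_min_eventually_eq m [set f | D f /\ vanish_from
  m f] f1.
- by [].
- by move=> f g [_ mf] [_ mg] i le_mi; rewrite mf ?mg.
exists f => // g Dg; have [mg|nmg] := pselect (vanish_from m g);
  first exact: minf.
have [k /levelP[kg g0]] := (omega_pow_vanish g).1 (fsD _ Dg).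
have lt_m : (m < level g)%N.
  by rewrite ltnNge; apply: contra_notN nmg => le_gm i le_mi;
    apply/kg/leq_trans/le_mi.
case: g0 => [g0|/eqP g0]; first by rewrite g0 in lt_m.
right; exists (level g).-1; rewrite mf; last by rewrite -ltnS (ltn_predK lt_m).
split=> [|i]; first by rewrite lt0n.
by rewrite ltEnat /= => lt_i; rewrite kg ?mf //; lia.
Qed.

Lemma lex_total f g : omega_pow nat f -> omega_pow nat g ->
  [\/ f = g, lex f g | lex g f].
Proof.
move=> ff fg; have [||h [->|->] minh] := @lex_min [set f; g] f.
- by left.
- by move=> _ [->|->].
- by have [->|] := minh g (or_intror erefl); [apply: Or31|apply: Or32].
- by have [->|] := minh f (or_introl erefl); [apply: Or31|apply: Or33].
Qed.

End LexicographicOrder.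

(** * Real numbers ordered like finitely supported functions *)

Section SclValues.
Local Open Scope ring_scope.
Variable R : realType.
Implicit Types (f g : nat -> nat) (m i b : nat).

(** The successor makes the exponents strictly decreasing in [i] below [m]; the added 2 gives p >=
    4, so that q = p - 3 is positive. *)
Definition exponent m f i : nat := (\sum_(i <= j < m) (f j).+1 + 2)%N.

Local Notation halfpow m f i := (2^-1 ^+ exponent m f i : R).

Definition defect m f : R := halfpow m f 0 + \sum_(0 <= i < m) halfpow m f i.

(** This is the scl of the chain with block indices 0, 0, 1, ..., m; the zero function gets the scl
    of the identity. *)
Definition value f : R :=
  if level f is m.+1 then m.+2%:R + m.+1%:R / 2 - defect m.+1 f / 2 else 0.

Lemma exponentS m f i : (i < m)%N ->
  exponent m f i = (exponent m f i.+1 + (f i).+1)%N.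
Proof. by move=> im; rewrite /exponent big_ltn // addnC addnA addnC; lia. Qed.

Lemma halfpow_gt0 n : 0 < 2^-1 ^+ n :> R.
Proof. by rewrite exprn_gt0. Qed.

Lemma halfpow_le n k : (n < k)%N -> 2 * 2^-1 ^+ k <= 2^-1 ^+ n :> R.
Proof.
move=> /subnKC <-; rewrite addSnnS exprD exprS mulrCA (mulrA 2).
rewrite divff ?pnatr_eq0 ?mul1r ?ler_piMr ?(ltW (halfpow_gt0 _)) //.
by apply: exprn_ile1; lra.
Qed.

(* The doubled term 2^-k_0 makes the terms below index b telescope. *)
Lemma defect_partial m f b : (b < m)%N ->
  halfpow m f 0 + \sum_(0 <= i < b) halfpow m f i <= halfpow m f b.
Proof.
elim: b => [|b IHb] bm; first by rewrite big_geq ?addr0.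
rewrite big_nat_recr //= addrA; have := IHb (ltnW bm).
have lt_e : (exponent m f b.+1 < exponent m f b)%N.
  by rewrite (exponentS m f b) ?(ltnW bm) // -ltn_subLR ?subnn.
by have := halfpow_le _ _ lt_e; lra.
Qed.

(** All terms together are at most twice the last one. The bound by 1 confines the values of one
    level to an interval of length 1/2. *)
Lemma defect_bounds m f : 0 < defect m.+1 f <= 1.
Proof.
rewrite /defect; apply/andP; split.
  by rewrite ltr_wpDr ?halfpow_gt0 // sumr_ge0 // => i _; apply/ltW/halfpow_gt0.
rewrite big_nat_recr //= addrA; have := @defect_partial m.+1 f m (ltnSn m).
have := halfpow_le 0 (exponent m.+1 f m); rewrite expr0.
have -> : (0 < exponent m.+1 f m)%N by rewrite /exponent; lia.
by move=> /(_ isT); lra.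
Qed.

(** At equal levels the terms above [b] agree. Those of [g] up to [b] add up to at most twice its
    term at [b], hence to at most the term of [f] at [b]; the extra first term of [f] makes the
    inequality strict. *)
Lemma value_lt f g : omega_pow nat f -> omega_pow nat g ->
  @omega_pow_lt _ nat f g -> value f < value g.
Proof.
move=> /omega_pow_vanish[mf /levelP[ff _]] /omega_pow_vanish[mg /levelP[gg _]].
move=> [b [fgb eqb]].
have lt_b : (b < level g)%N.
  by rewrite ltnNge; apply/negP => /gg gb; rewrite gb in fgb.
have lt_fg : (level f <= level g)%N.
  apply: level_le => i le_i; rewrite eqb ?gg //.
  exact: leq_trans lt_b le_i.
have nS k : k.+1%:R = k%:R + 1 :> R by rewrite natr1.
rewrite /value; case: (level f) (level g) lt_b lt_fg {ff gg} => [|m] [|n] //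
  lt_bn le_mn.
  by have /andP[_] := defect_bounds n g; have := ler0n R n;
    rewrite (nS n.+1) (nS n); lra.
(* For distinct levels the main terms differ by at least 3/2, and the defects lower the values by at
   most 1/2. *)
rewrite ltnS leq_eqVlt in le_mn; case/predU1P: le_mn => [->|lt_mn]; last first.
  have /andP[_] := defect_bounds n g; have /andP[+ _] := defect_bounds m f.
  have : m%:R + 1 <= n%:R :> R by rewrite natr1 ler_nat.
  by rewrite (nS n.+1) (nS n) (nS m.+1) (nS m); lra.
have expE i : (b < i)%N -> exponent n.+1 f i = exponent n.+1 g i.
  move=> bi; congr (_ + _)%N; apply: eq_big_nat => j /andP[le_ij _].
  by rewrite eqb // ltEnat; exact: leq_trans bi le_ij.
suff ltd : defect n.+1 g < defect n.+1 f by rewrite ltrD2l ltrN2 ltr_pM2r.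
have split h : \sum_(0 <= i < n.+1) halfpow n.+1 h i =
    \sum_(0 <= i < b) halfpow n.+1 h i + (halfpow n.+1 h b
    + \sum_(b.+1 <= i < n.+1) halfpow n.+1 h i).
  by rewrite (@big_cat_nat _ _ _ b) ?(ltnW lt_bn) //= (big_ltn lt_bn).
rewrite /defect !split.
have -> : \sum_(b.+1 <= i < n.+1) halfpow n.+1 f i =
          \sum_(b.+1 <= i < n.+1) halfpow n.+1 g i.
  by apply: eq_big_nat => i /andP[bi _]; rewrite expE.
have := defect_partial n.+1 g b lt_bn.
have lt_e : (exponent n.+1 f b < exponent n.+1 g b)%N.
  by rewrite !(exponentS n.+1 _ b) // expE // ltn_add2l ltnS.
have := halfpow_le _ _ lt_e.
have := halfpow_gt0 (exponent n.+1 f 0).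
have : 0 <= \sum_(0 <= i < b) halfpow n.+1 f i.
  by apply: sumr_ge0 => i _; apply/ltW/halfpow_gt0.
set x := \sum_(_ <= _ < _) _; set y := \sum_(_ <= _ < _) _;
  set z := \sum_(_ <= _ < _) _.
lra.
Qed.

Lemma value_lt_iff f g : omega_pow nat f -> omega_pow nat g ->
  @omega_pow_lt _ nat f g <-> value f < value g.
Proof.
move=> ff fg; split; first exact: value_lt.
case: (lex_total f g ff fg) => [->|//|gf]; first by rewrite ltxx.
by rewrite (lt_gtF (value_lt g f fg ff gf)).
Qed.
End SclValues.

(** * The values as stable commutator lengths *)

Section SclImage.
Local Open Scope ring_scope.
Variables (R : realType).
Implicit Types (f g : nat -> nat).

Lemma scl1 (G : groupType) : scl R (1 : G)%g = 0.
Proof.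
apply: scl_eq; exists 0 => N; rewrite expg1n mul0r.
  by exists 0%N; [exact: commutator_product1 | rewrite addr0].
by move=> k _; rewrite subr0.
Qed.

Lemma value_in_scl_image (X : choiceType) (rho : X -> nat) (e : nat -> X) M f :
  injective rho -> {in [pred k | (k <= M.*2)%N], cancel e rho} ->
  vanish_from M f -> scl_image (free_group X) R (value R f).
Proof.
move=> rho_inj eK Mf; have := level_le _ _ Mf; rewrite /value.
case: (level f) => [_|m mM].
  exists 1%g; last exact: scl1.
  by apply: (commutator_product_derived _ _ 0); exact: commutator_product1.
pose q i := (2 ^ exponent m.+1 f i - 3)%N.
have pE i : (q i).+3 = (2 ^ exponent m.+1 f i)%N.
  have : (2 ^ 2 <= 2 ^ exponent m.+1 f i)%N by rewrite leq_exp2l // /exponent;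
    lia.
  by rewrite /q; lia.
have q0 i : (0 < q i)%N.
  have : (2 ^ 2 <= 2 ^ exponent m.+1 f i)%N by rewrite leq_exp2l // /exponent;
    lia.
  by rewrite /q; lia.
pose b i := e i.*2.+1; pose a i := e i.*2.+2.
have rc : rho (e 0%N) = 0%N by rewrite eK.
have rb i : (i < m.+1)%N -> rho (b i) = i.*2.+1 by move=> im;
  rewrite /b eK // inE; lia.
have ra i : (i < m.+1)%N -> rho (a i) = i.*2.+2 by move=> im;
  rewrite /a eK // inE; lia.
have lt0 : {in [:: 0%N, 0%N & iota 1 m], forall j, (j < m.+1)%N}.
  by move=> j; rewrite !inE mem_iota; lia.
(* Repeating the index 0 provides two blocks even when [m] is 0; it accounts for the doubled term in
   [defect]. *)
exists (block_chain X q b a (e 0%N) 0 (0%N :: iota 1 m)).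
  exact: derived_block_chain.
rewrite (scl_block_chain R X rho rho_inj q b a (e 0%N) m.+1) // size_iota.
rewrite (eq_bigr (fun j => 1 - 2^-1 * 2^-1 ^+ exponent m.+1 f j)); last first.
  by move=> j _; rewrite pE natrX invfM exprVn.
rewrite big_cons (_ : 0%N :: iota 1 m = index_iota 0 m.+1) //.
rewrite sumrB -mulr_sumr big_const_seq count_predT iter_addr_0 size_iota subn0.
by rewrite /defect -[m.+2%:R]natr1; field.
Qed.

(** A nonempty subset is pulled back to functions; [value] is increasing, so their lexicographic
    minimum gives the least element. *)
Lemma value_wo_chain (S : set R) :
  S `<=` value R @` omega_pow nat -> wo_chain (<=%R : rel R) (mem S).
Proof.
move=> sS; apply: antisymmetric_wo_chain => [x y _ _|A sA [x Ax]].
  exact: le_anti.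
have [f0 ff0 f0x] := sS _ (set_mem (sA _ Ax)).
have [f [Af ff] minf] := lex_min [set f | value R f \in A /\ omega_pow nat f] f0
  (conj (eq_ind_r (fun z => z \in A) Ax f0x) ff0) (fun f => @proj2 _ _).
exists (value R f); split=> // y Ay; have [g fg gy] := sS _ (set_mem (sA _ Ay)).
have Dg : [set f | value R f \in A /\ omega_pow nat f] g by split; rewrite ?gy.
by rewrite -gy; have [->//|fg'] := minf g Dg; apply/ltW/value_lt.
Qed.

End SclImage.

Theorem mainTheorem3 (R : realType) :
  (forall n : nat, (0 < n)%N ->
     exists S : set R, S `<=` scl_image (free_group 'I_n) R /\
       well_ordered_of_type_omega_pow 'I_(n %/ 4) S) /\
  (exists S : set R, S `<=` scl_image (free_group nat) R /\
     well_ordered_of_type_omega_pow nat S).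
Proof.
split=> [n n0|]; last first.
  exists (value R @` omega_pow nat); split.
    move=> _ [f /omega_pow_vanish[M Mf] <-].
    exact: (@value_in_scl_image R nat id id M).
  split; first exact: value_wo_chain.
  exists (value R); split; last first.
    by move=> f g /set_mem ff /set_mem fg; apply: value_lt_iff.
  split=> // f g /set_mem ff /set_mem fg efg.
  by case: (lex_total f g ff fg) => // /(value_lt R) H;
    [have := H ff fg | have := H fg ff]; rewrite efg ltxx.
(* Extension by zero reduces the finite case to functions on [nat]; an index where two extensions
   differ lies below [n %/ 4], so the order is preserved and reflected. *)
pose ext (f : 'I_(n %/ 4) -> nat) i := if insub i is Some j then f j else 0%N.
have extE f (j : 'I_(n %/ 4)) : ext f j = f j by rewrite /ext valK.
have ext0 f : vanish_from (n %/ 4) (ext f).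
  by move=> i le_i; rewrite /ext insubN // -leqNgt.
have extP f : omega_pow nat (ext f) by apply/omega_pow_vanish;
  exists (n %/ 4)%N.
have ext_lt f g : @omega_pow_lt _ _ f g <-> @omega_pow_lt _ nat (ext f) (ext g).
  split=> [[j [fgj eqj]]|[i [fgi eqi]]].
    exists (j : nat); rewrite !extE; split=> // i; rewrite ltEnat /= => lt_ji.
    by rewrite /ext; case: insubP => [k _ ki|//]; apply: eqj; rewrite ltEord ki.
  have i_lt : (i < n %/ 4)%N.
    by rewrite ltnNge; apply: contraTN fgi => /(ext0 g) ->.
  exists (Ordinal i_lt); rewrite -(extE f) -(extE g); split=> // j lt_ij.
  by rewrite -(extE f) -(extE g); apply: eqi.
exists ((value R \o ext) @` omega_pow 'I_(n %/ 4)); split.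
  move=> _ [f _ <-].
  apply: (@value_in_scl_image R _ (@nat_of_ord n) (insubd (Ordinal n0)) (n %/
    4)).
  - exact: ord_inj.
  - move=> k; rewrite inE => le_k; rewrite val_insubd.
    (* The 2(n/4) + 1 generators in use exist: this number is at most [n], as [n] is positive. *)
    by case: ifP => // /negP[]; have := leq_divM n 4; lia.
  - exact: ext0.
split; first by apply: value_wo_chain => _ [f _ <-]; exists (ext f).
exists (value R \o ext); split; last first.
  by move=> f g _ _; rewrite ext_lt; apply: value_lt_iff.
split=> // f g _ _ /= efg.
suff eext : ext f = ext g by apply/funext => j; rewrite -(extE f) eext.
by case: (lex_total (ext f) (ext g)) => // /(value_lt R) H;
    [have := H (extP _) (extP _) | have := H (extP _) (extP _)];
      rewrite efg ltxx.
Qed.
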